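(* Let $r>1$ and let $\mathcal{T}=\{\mathcal{T}_1,\mathcal{T}_2,\ldots,\mathcal{T}_r\}$ (the one-factors) and $\mathcal{R}$ (the triples) form an $(n,r)$-pairs-triples design on $\mathbb{Z}_n$. Let $\mathcal{C}$ be the set of words over $\mathbb{Z}_2^n\times\mathbb{Z}_{r+1}$ consisting of: (1) for each $\{x,y,z\}\in\mathcal{R}$, the word with ones exactly in the binary coordinates $x,y,z$ and $0$ in the last coordinate; and (2) for each $1\le i\le r$ and each $\{x,y\}\in\mathcal{T}_i$, the word with ones exactly in the binary coordinates $x,y$ (among the first $n$ coordinates) and the letter $i$ in the last coordinate. Then $\mathcal{C}$ is a mixed Steiner system $\mathrm{MS}(2,3,\mathbb{Z}_2^n\times\mathbb{Z}_{r+1})$.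
   Context: An $(n,r)$-pairs-triples design, with $r<n-1$, consists of a set $\mathcal{T}$ of $r$ pairwise disjoint one-factors (perfect matchings) of the complete graph $K_n$ on the vertex set $\mathbb{Z}_n$ and a set $\mathcal{R}$ of triples ($3$-subsets) of $\mathbb{Z}_n$ such that each pair of elements of $\mathbb{Z}_n$ is contained exactly once, either as an edge of a one-factor of $\mathcal{T}$ or in a triple of $\mathcal{R}$. The first $n$ coordinates of $\mathbb{Z}_2^n\times\mathbb{Z}_{r+1}$ are indexed by the points of $\mathbb{Z}_n$. For integers $q_1,\dots,q_N\ge 2$ let $Q=\mathbb{Z}_{q_1}\times\cdots\times\mathbb{Z}_{q_N}$, viewed as the set of words of length $N$ whose $i$-th letter lies in $\mathbb{Z}_{q_i}$. The weight of a word is its number of nonzero coordinates, and $d(\cdot,\cdot)$ is the Hamming distance. For integers $1\le t\le k\le N$, a mixed Steiner system $\mathrm{MS}(t,k,Q)$ is a set $\mathcal{C}$ of words of $Q$ of weight $k$ such that (i) for every word $x\in Q$ of weight $t$ there is exactly one $c\in\mathcal{C}$ with $d(x,c)=k-t$; and (ii) any two distinct elements of $\mathcal{C}$ are at Hamming distance at least $2(k-t)+1$. *)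

(* Defs.v *)
From HB Require Import structures.
From mathcomp Require Import all_boot all_algebra.

Set Implicit Arguments.
Unset Strict Implicit.
Unset Printing Implicit Defensive.

(* ['Z_m] is the ring of integers modulo m only for 1 < m; the bound
   1 < q i is part of [mixed_steiner_system]. *)
Definition word N (q : 'I_N -> nat) := {dffun forall i : 'I_N, 'Z_(q i)}.

Definition weight N (q : 'I_N -> nat) (u : word q) : nat :=
  #|[set i | u i != 0%R]|.

Definition hamming N (q : 'I_N -> nat) (u v : word q) : nat :=
  #|[set i | u i != v i]|.

Record mixed_steiner_system (t k N : nat) (q : 'I_N -> nat)
    (C : {set word q}) : Prop := MixedSteinerSystem {
  mss_range : 1 <= t <= k <= N;
  mss_alphabet : forall i, 1 < q i;
  mss_weight : forall c, c \in C -> weight c = k;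
  mss_cover : forall x : word q, weight x = t ->
    exists! c : word q, c \in C /\ hamming x c = k - t;
  mss_distance : forall c c', c \in C -> c' \in C -> c <> c' ->
    2 * (k - t) + 1 <= hamming c c'
}.

(* Edges of the complete graph on ['I_n] are the 2-subsets of ['I_n]. *)
Definition one_factor n (F : {set {set 'I_n}}) : Prop :=
  partition F [set: 'I_n] /\ (forall e, e \in F -> #|e| = 2).

Record pairs_triples_design n r (T : 'I_r -> {set {set 'I_n}})
    (R : {set {set 'I_n}}) : Prop := PairsTriplesDesign {
  ptd_bound : r < n - 1;
  ptd_one_factor : forall i, one_factor (T i);
  ptd_disjoint : forall i j, i != j -> [disjoint T i & T j];
  ptd_triple : forall B, B \in R -> #|B| = 3;
  ptd_pair : forall x y : 'I_n, x != y ->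
    #|[set i | [set x; y] \in T i]| + #|[set B in R | [set x; y] \subset B]| = 1
}.

(* The alphabet sizes of Z_2^n x Z_m: coordinate [lift ord_max x] is the binary
   coordinate of the point x, and [ord_max] is the last coordinate. *)
Definition binary_then n m (j : 'I_n.+1) : nat :=
  if unlift ord_max j is Some _ then 2 else m.

Definition pt_word n m (A : {set 'I_n}) (a : nat) : word (@binary_then n m) :=
  [ffun j => ((if unlift ord_max j is Some x then nat_of_bool (x \in A) else a)%:R)%R].

(* The one-factors are indexed from 0, so the letter attached to [T i] is i + 1. *)
Definition pt_code n r (T : 'I_r -> {set {set 'I_n}}) (R : {set {set 'I_n}}) :
    {set word (@binary_then n r.+1)} :=
  [set pt_word r.+1 B 0 | B in R]
    :|: \bigcup_(i < r) [set pt_word r.+1 e i.+1 | e in T i].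

(* Main.v *)
Require Import Defs.
From HB Require Import structures.
From mathcomp Require Import all_boot all_algebra.
From mathcomp Require Import zify.

Set Implicit Arguments.
Unset Strict Implicit.
Unset Printing Implicit Defensive.

(** Two blocks of the design never share a pair of points, so codewords are at
    distance at least 3.  A word of weight 2 is either a pair of points, which
    lies in a triple or is an edge of a one-factor, or a point together with a
    letter i, which is covered by the edge through that point in the i-th
    one-factor; each gives a codeword at distance 1.  It is unique because two
    such codewords would be at distance at most 2. *)

Lemma hammingC N (q : 'I_N -> nat) (u v : word q) : hamming u v = hamming v u.
Proof. by rewrite /hamming; apply: eq_card => i; rewrite !inE eq_sym. Qed.

Lemma hamming_triangle N (q : 'I_N -> nat) (v u w : word q) :
  hamming u w <= hamming u v + hamming v w.
Proof.
apply: leq_trans (leq_card_setU _ _); apply: subset_leq_card.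
apply/subsetP => i; rewrite !inE -negb_and.
by apply: contra => /andP[/eqP-> /eqP->].
Qed.

Lemma eq_Zp_nat p a b : 1 < p ->
  ((a%:R)%R == (b%:R)%R :> 'Z_p) = (a == b %[mod p]).
Proof. by move=> p_gt1; rewrite -val_eqE /= !val_Zp_nat. Qed.

(** The zero word is [pt_word m set0 0], so weights become a special case of the distance formula
    below. *)
Lemma weight_hamming n m (u : word (@binary_then n m)) :
  weight u = hamming u (pt_word m set0 0).
Proof.
apply: eq_card => j; rewrite !inE ffunE.
by case: unliftP => [x _|_]; rewrite ?inE.
Qed.

(** The binary coordinates contribute the symmetric difference of [A] and [B], the last one
    contributes 0 or 1. The bounds on [a] and [b] keep distinct letters distinct modulo [m]. *)
Lemma hamming_pt_word n m (A B : {set 'I_n}) a b : 1 < m -> a < m -> b < m ->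
  hamming (pt_word m A a) (pt_word m B b) =
    #|A :\: B| + #|B :\: A| + (a != b).
Proof.
move=> m_gt1 am bm; rewrite /hamming -sum1dep_card big_mkcond /=.
rewrite (bigD1_ord ord_max) //= addnC !ffunE; congr (_ + _); last first.
  by rewrite eq_Zp_nat /binary_then unlift_none // !modn_small //; case: eqP.
rewrite -!sum1_card !(big_mkcond (fun i => i \in _)) -big_split /=.
apply: eq_bigr => x _; rewrite !ffunE eq_Zp_nat /binary_then liftK // !inE.
by case: (x \in A); case: (x \in B).
Qed.

Lemma weight_pt_word n m (A : {set 'I_n}) a : 1 < m -> a < m ->
  weight (pt_word m A a) = #|A| + (a != 0).
Proof.
move=> m_gt1 am; rewrite weight_hamming hamming_pt_word ?(ltnW m_gt1) //.
by rewrite setD0 set0D cards0 addn0.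
Qed.

(** Allows an arbitrary word of weight 2 to be analysed through its support and its last letter. *)
Lemma pt_word_surj n m (u : word (@binary_then n m)) : 1 < m ->
  exists A a, a < m /\ u = pt_word m A a.
Proof.
move=> m_gt1; exists [set x | u (lift ord_max x) != 0%R], (val (u ord_max)).
have bm : binary_then m (ord_max : 'I_n.+1) = m by rewrite /binary_then unlift_none.
split.
  (* The type of the letter depends on [binary_then], so the letter is generalized before the
     alphabet size is rewritten. *)
  move: (u ord_max); rewrite bm => z.
  by apply: leq_trans (ltn_ord z) _; rewrite Zp_cast.
apply/ffunP => j; rewrite ffunE; case: unliftP => [x ->|->]; last by rewrite natr_Zp.
rewrite inE.
have b2 : binary_then m (lift ord_max x) = 2 by rewrite /binary_then liftK.
move: (u _); rewrite b2 => z.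
by case: z => [[|[|k]] lt] //; apply: val_inj.
Qed.

Lemma pt_codeP n r (T : 'I_r -> {set {set 'I_n}}) (R : {set {set 'I_n}}) c :
  reflect ((exists2 B, B \in R & c = pt_word r.+1 B 0) \/
           (exists i e, e \in T i /\ c = pt_word r.+1 e i.+1))
          (c \in pt_code T R).
Proof.
apply: (iffP setUP) => [[/imsetP[B BR ->]|/bigcupP[i _ /imsetP[e eT ->]]]|].
- by left; exists B.
- by right; exists i, e.
- case=> [[B BR ->]|[i [e [eT ->]]]]; first by left; apply: imset_f.
  by right; apply/bigcupP; exists i => //; apply: imset_f.
Qed.

Section Design.

Variables (n r : nat) (T : 'I_r -> {set {set 'I_n}}) (R : {set {set 'I_n}}).
Hypothesis hD : pairs_triples_design T R.

Lemma card_edge i e : e \in T i -> #|e| = 2.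
Proof. by have [_] := ptd_one_factor hD i; apply. Qed.

(** Two common points would form a pair covered by two triples. *)
Lemma triple_triple_meet B B' :
  B \in R -> B' \in R -> B != B' -> #|B :&: B'| <= 1.
Proof.
move=> BR B'R; rewrite leqNgt; apply: contra.
case/card_gt1P => x [y [/setIP[xB xB'] /setIP[yB yB'] nxy]].
have : #|[set B in R | [set x; y] \subset B]| <= 1.
  by rewrite -(ptd_pair hD nxy) leq_addl.
move/card_le1_eqP => /(_ B B') -> //; rewrite inE ?BR ?B'R subUset !sub1set;
  exact/and3P.
Qed.

(** Two common points would make up all of [e], and this pair would be counted in both terms of
    [ptd_pair]. *)
Lemma triple_edge_meet B i e : B \in R -> e \in T i -> #|B :&: e| <= 1.
Proof.
move=> BR eT; rewrite leqNgt; apply/negP.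
case/card_gt1P => x [y [/setIP[xB xe] /setIP[yB ye] nxy]].
have exy : [set x; y] = e.
  by apply/eqP; rewrite eqEcard subUset !sub1set xe ye cards2 nxy (card_edge eT).
have T_gt0 : 0 < #|[set i | [set x; y] \in T i]|.
  by apply/card_gt0P; exists i; rewrite inE exy.
have R_gt0 : 0 < #|[set B in R | [set x; y] \subset B]|.
  by apply/card_gt0P; exists B; rewrite inE BR subUset !sub1set xB.
by have := leq_add T_gt0 R_gt0; rewrite (ptd_pair hD nxy).
Qed.

(** Edges with two common points coincide, but distinct one-factors share no edge. *)
Lemma edge_edge_meet i j e f :
  e \in T i -> f \in T j -> i != j -> #|e :&: f| <= 1.
Proof.
move=> eT fT nij; rewrite leqNgt; apply/negP => h.
have ef : e = f.
  transitivity (e :&: f); [symmetry|]; apply/eqP.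
    by rewrite eqEcard subsetIl (card_edge eT).
  by rewrite eqEcard subsetIr (card_edge fT).
by have /pred0P/(_ e) := ptd_disjoint hD nij; rewrite /= eT ef fT.
Qed.

Lemma edge_edge_disjoint i e f :
  e \in T i -> f \in T i -> e != f -> #|e :&: f| = 0.
Proof.
move=> eT fT nef; have [/and3P[_ /trivIsetP tI _] _] := ptd_one_factor hD i.
by apply/eqP; rewrite cards_eq0 setI_eq0; apply: tI.
Qed.

(** The intersection bounds give distance at least 2+2 for two triples, 2+1+1 for a triple and an
    edge, 1+1+1 for edges of different one-factors, and 2+2 for edges of the same one-factor, where
    the letters agree. *)
Lemma pt_code_distance c c' : 1 < r ->
  c \in pt_code T R -> c' \in pt_code T R -> c <> c' -> 3 <= hamming c c'.
Proof.
move=> r_gt1 /pt_codeP h /pt_codeP h'.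
have meet D k g : D \in R -> g \in T k ->
    3 <= hamming (pt_word r.+1 D 0) (pt_word r.+1 g k.+1).
  move=> DR gT; have kr := ltn_ord k; rewrite hamming_pt_word ?cardsD; try lia.
  have := triple_edge_meet DR gT; rewrite (setIC g) (ptd_triple hD DR).
  by rewrite (card_edge gT); lia.
case: h h' => [[B BR ->]|[i [e [eT ->]]]] [[B' B'R ->]|[j [f [fT ->]]]] ne.
- have nB : B != B' by apply/eqP => E; apply: ne; rewrite E.
  have := triple_triple_meet BR B'R nB.
  rewrite hamming_pt_word ?cardsD; try lia.
  by rewrite (setIC B') (ptd_triple hD BR) (ptd_triple hD B'R); lia.
- exact: meet.
- by rewrite hammingC; apply: meet.
- have := ltn_ord i; have := ltn_ord j => jr ir.
  rewrite hamming_pt_word ?cardsD; try lia.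
  rewrite (setIC f) (card_edge eT) (card_edge fT).
  have [E|nij] := eqVneq i j; last first.
    have := edge_edge_meet eT fT nij; move: nij; rewrite -val_eqE /=; lia.
  subst j; have nef : e != f by apply/eqP => E; apply: ne; rewrite E.
  by rewrite (edge_edge_disjoint eT fT nef); lia.
Qed.

Lemma pt_code_cover (u : word (@binary_then n r.+1)) : 1 < r -> weight u = 2 ->
  exists2 c, c \in pt_code T R & hamming u c = 1.
Proof.
move=> r_gt1; have m_gt1 : 1 < r.+1 by lia.
(* Last letter 0 leaves two points in [A]; a nonzero letter [a.+1] leaves one. *)
have [A [[|a] [ar ->]]] := pt_word_surj u m_gt1; rewrite weight_pt_word //.
  rewrite addn0 => /eqP/cards2P[x [y [nxy ->]]].
  have := ptd_pair hD nxy; case: (posnP #|[set i | [set x; y] \in T i]|) => [->|].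
    rewrite add0n => /eqP/cards1P[B /setP/(_ B)]; rewrite !inE eqxx => /andP[BR sB].
    exists (pt_word r.+1 B 0); first by apply/pt_codeP; left; exists B.
    rewrite hamming_pt_word // (cardsDS sB) (ptd_triple hD BR) cards2 nxy.
    by move: sB; rewrite -setD_eq0 => /eqP->; rewrite cards0.
  case/card_gt0P => i; rewrite inE => eT _.
  exists (pt_word r.+1 [set x; y] i.+1).
    by apply/pt_codeP; right; exists i, [set x; y].
  (* The supports agree, so only the last letter differs. *)
  by rewrite hamming_pt_word ?ltnS // setDv cards0.
rewrite addn1 => -[/eqP/cards1P[x ->]].
(* The letter [a.+1] belongs to the one-factor of index [a], and [a.+1 < r.+1] is convertible to
   [a < r]. *)
have [/and3P[/eqP cov _ _] _] := ptd_one_factor hD (Ordinal (ar : a < r)).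
have : x \in cover (T (Ordinal (ar : a < r))) by rewrite cov inE.
case/bigcupP => e eT xe; exists (pt_word r.+1 e a.+1).
  by apply/pt_codeP; right; exists (Ordinal (ar : a < r)), e.
have sxe : [set x] \subset e by rewrite sub1set.
rewrite hamming_pt_word // (cardsDS sxe) (card_edge eT) cards1 eqxx.
by move: sxe; rewrite -setD_eq0 => /eqP->; rewrite cards0.
Qed.

End Design.

Theorem theorem17 (n r : nat) (T : 'I_r -> {set {set 'I_n}})
    (R : {set {set 'I_n}}) (hr : 1 < r) (hD : pairs_triples_design T R) :
  @mixed_steiner_system 2 3 n.+1 (@binary_then n r.+1) (pt_code T R).
Proof.
split.
(* From [1 < r < n - 1], the length [n.+1] is at least 3. *)
- by have := ptd_bound hD; lia.
- by move=> j; rewrite /binary_then; case: unlift => [_|]; lia.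
- move=> c /pt_codeP[[B BR ->]|[i [e [eT ->]]]]; rewrite weight_pt_word ?ltnS //; try lia.
    by rewrite (ptd_triple hD BR).
  by rewrite (card_edge hD eT).
- move=> u /(pt_code_cover hD hr)[c cC uc]; exists c; split=> // c' [c'C uc'].
  apply/eqP/negPn/negP => /eqP ne.
  have := pt_code_distance hD hr cC c'C ne.
  by have := hamming_triangle u c c'; rewrite (hammingC c u) uc uc'; lia.
- by move=> c c' cC c'C /(pt_code_distance hD hr cC c'C).
Qed.
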